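(* Let $\Delta$, $k$, and $n$ be natural numbers. Let $\mathcal{G}$ be a $\Delta$-temporally connected temporal graph on $n$ vertices, and let $T$ be a spanning tree of the underlying graph of $\mathcal{G}$. If $\mathcal{G}$ contains at least $\lceil 18k \ln(6k) \rceil\left(\Delta+ \frac{n}{k}\right)$ snapshots that are $k$-edge-deficient with respect to $T$, then $\mathcal{G}$ can be explored from any vertex.
   Context: A temporal graph $\mathcal{G}$ is an ordered sequence $\langle G_1,\dots,G_L\rangle$ of graphs on a common vertex set; the $G_i$ are its snapshots and $L$ is its lifetime. Its underlying graph is the static graph on the same vertex set whose edges are those appearing in at least one snapshot. For $1\le t\le t'\le L$, $\mathcal{G}_{[t,t']}=\langle G_t,\dots,G_{t'}\rangle$. A temporal walk from $v$ to $u$ is a sequence $(v=v_0,e_1,v_1,\dots,e_\ell,v_\ell=u)$ with strictly increasing time steps $1\le t_1<\dots<t_\ell\le L$ such that each edge $e_i=\{v_{i-1},v_i\}$ is present in $G_{t_i}$; its length is $\ell$. $\mathcal{G}$ can be explored from $v$ in at most $\ell$ steps if there is a temporal walk of length at most $\ell$ starting at $v$ and visiting all vertices; it can be explored from $v$ if it can be explored from $v$ in at most $L$ steps. $\mathcal{G}$ is temporally connected if for every ordered pair of vertices $(v,u)$ there is a temporal walk from $v$ to $u$; it is $\Delta$-temporally connected if $\mathcal{G}_{[t,t+\Delta-1]}$ is temporally connected for every $t\in[L-\Delta+1]$. For a static graph $F$ on the same vertex set, a snapshot $G$ is $k$-edge-deficient with respect to $F$ if all but at most $k$ edges of $F$ are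 present in $G$. *)

(* Defs.v *)
From Stdlib Require Import Reals.
From mathcomp Require Import all_boot.

Set Implicit Arguments.
Unset Strict Implicit.
Unset Printing Implicit Defensive.

(* A temporal graph on the finite vertex set V with lifetime L is given by
   G : nat -> rel V, where G t is the adjacency relation of snapshot G_t
   for t in 1..L (values outside 1..L are irrelevant).  Snapshots are
   simple graphs: symmetric and irreflexive relations. *)
Definition is_simple_graph (V : finType) (E : rel V) : Prop :=
  (forall u v, E u v = E v u) /\ (forall v, ~~ E v v).

Definition temporal_graph (V : finType) (L : nat) (G : nat -> rel V) : Prop :=
  forall t, 1 <= t <= L -> is_simple_graph (G t).

(* A temporal walk starting at v inside the time window [a, b]: the
   sequence s = [:: (t_1, v_1); ...; (t_l, v_l)] with
   0 < t_1 < ... < t_l, all t_i in [a, b], and {v_(i-1), v_i} in G_(t_i)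
   (v_0 = v).  Its length is size s. *)
Definition walk_step (V : finType) (G : nat -> rel V) (p q : nat * V) : bool :=
  (p.1 < q.1) && G q.1 p.2 q.2.

Definition twalk_in (V : finType) (G : nat -> rel V) (a b : nat) (v : V)
  (s : seq (nat * V)) : bool :=
  path (walk_step G) (0, v) s && all (fun p => a <= p.1 <= b) s.

Definition twalk (V : finType) (L : nat) (G : nat -> rel V) (v : V)
  (s : seq (nat * V)) : bool := twalk_in G 1 L v s.

Definition walk_end (V : finType) (v : V) (s : seq (nat * V)) : V :=
  last v (map snd s).

Definition temporally_connected_in (V : finType) (G : nat -> rel V) (a b : nat) : Prop :=
  forall v u : V, exists s, twalk_in G a b v s /\ walk_end v s = u.

Definition Delta_temporally_connected (V : finType) (L : nat) (G : nat -> rel V)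
  (Delta : nat) : Prop :=
  forall t, 1 <= t -> t + Delta <= L + 1 ->
    temporally_connected_in G t (t + Delta - 1).

Definition explorable_in (V : finType) (L : nat) (G : nat -> rel V) (v : V) (l : nat) : Prop :=
  exists s, twalk L G v s /\ size s <= l /\ forall x : V, x \in v :: map snd s.

Definition explorable (V : finType) (L : nat) (G : nat -> rel V) (v : V) : Prop :=
  explorable_in L G v L.

Definition underlying (V : finType) (L : nat) (G : nat -> rel V) : rel V :=
  fun u v => [exists t : 'I_L.+1, (1 <= t) && G t u v].

Definition acyclic (V : finType) (T : rel V) : Prop :=
  forall c : seq V, uniq c -> 2 < size c -> ~~ cycle T c.

Definition connected_graph (V : finType) (T : rel V) : Prop :=
  forall u v : V, connect T u v.

Definition spanning_tree_of (V : finType) (T F : rel V) : Prop :=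
  [/\ is_simple_graph T, subrel T F, connected_graph T & acyclic T].

Definition missing_edges (V : finType) (F E : rel V) : {set {set V}} :=
  [set e : {set V} | [exists u : V, [exists w : V,
      (e == [set u; w]) && F u w && ~~ E u w]]].

Definition edge_deficient (V : finType) (k : nat) (F E : rel V) : bool :=
  #|missing_edges F E| <= k.

Definition num_deficient (V : finType) (L : nat) (G : nat -> rel V) (k : nat) (F : rel V) : nat :=
  count (fun t => edge_deficient k F (G t)) (iota 1 L).

Definition ceilR (x : R) : Z := (- Int_part (- x))%Z.

Local Open Scope R_scope.
Definition snapshot_threshold (k Delta n : nat) : R :=
  IZR (ceilR (18 * INR k * ln (6 * INR k))) * (INR Delta + INR n / INR k).

(* Main.v *)
(* A closed walk around the tree passes each edge at most twice and has 2(n-1)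
   steps. Split time into P = ceil(18 k ln(6k)) phases with Delta + floor(n/k)
   deficient snapshots each; the first Delta time steps of a phase bring the
   explorer to any position of the tour, and afterwards it follows the tour
   whenever the next edge is present. Put virtual walkers on the tour, each
   starting right behind the final position of the previous one: they never
   meet, so a deficient snapshot blocks at most 2k of them, and therefore at
   most 4k of them already cover the tour. Thus every phase partitions the tour
   into at most 4k intervals, each explorable in that phase. Choosing one
   interval per phase greedily covers all the breakpoints of all the partitions
   (at most 4kP of them, and 4kP(1 - 1/(4k))^P < 1), and then it covers
   everything. *)
Require Import Defs.
From Stdlib Require Import ZArith Reals Lra.
From mathcomp Require Import zify all_boot.

Set Implicit Arguments.
Unset Strict Implicit.
Unset Printing Implicit Defensive.

(* [%R] is taken over by MathComp's [ring_scope]. *)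
Delimit Scope R_scope with coqR.

(** * Real estimates for the number of phases *)

Lemma ceilR_bounds (x : R) : (x <= IZR (ceilR x) < x + 1)%coqR.
Proof.
rewrite /ceilR opp_IZR.
by have [] := base_Int_part (- x)%coqR; lra.
Qed.

Lemma INR_muln (m n : nat) : INR (m * n) = (INR m * INR n)%coqR.
Proof. by rewrite -mult_INR. Qed.

Lemma INR_addn (m n : nat) : INR (m + n) = (INR m + INR n)%coqR.
Proof. by rewrite -plus_INR. Qed.

Lemma INR_expn (m n : nat) : INR (m ^ n) = (INR m ^ n)%coqR.
Proof. by elim: n => [|n IHn] //=; rewrite expnS INR_muln IHn. Qed.

Lemma exp_INR_mult (n : nat) (x : R) : exp (INR n * x) = (exp x ^ n)%coqR.
Proof.
elim: n => [|n IHn]; first by rewrite Rmult_0_l exp_0.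
by rewrite S_INR Rmult_plus_distr_r Rmult_1_l exp_plus IHn /= Rmult_comm.
Qed.

(** This is [1 - 1/m <= exp (-1/m)] raised to the power [n]. *)
Lemma pred_expn_le (m n : nat) :
  0 < m -> (INR m.-1 ^ n <= INR m ^ n * exp (- (INR n / INR m)))%coqR.
Proof.
move=> m_gt0; have m0 : (0 < INR m)%coqR by apply: lt_0_INR; lia.
have -> : (- (INR n / INR m) = INR n * - / INR m)%coqR by rewrite /Rdiv; ring.
rewrite exp_INR_mult -Rpow_mult_distr; apply: pow_incr; split; first exact: pos_INR.
have -> : (INR m.-1 = INR m * (1 + - / INR m))%coqR.
  have -> : INR m = (INR m.-1 + 1)%coqR by rewrite -S_INR prednK.
  field; rewrite -S_INR prednK //; lra.
apply: Rmult_le_compat_l; first lra.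
exact: exp_ineq1_le.
Qed.

(** With [M = 4k] parts per phase, the last inequality says [P M (1 - 1/M)^P < 1]: greedy choice
    then leaves fewer than one breakpoint uncovered. The witness is the ceiling in the threshold. *)
Lemma phase_count (k Delta n c : nat) :
  0 < k -> (snapshot_threshold k Delta n <= INR c)%coqR ->
  exists P : nat, [/\ 0 < P, P * (Delta + n %/ k) <= c &
    P * (4 * k) * (4 * k).-1 ^ P < (4 * k) ^ P].
Proof.
move=> k_gt0; rewrite /snapshot_threshold.
set X := (18 * INR k * ln (6 * INR k))%coqR => thr.
have [cl cu] := ceilR_bounds X.
have k1 : (1 <= INR k)%coqR by apply: (le_INR 1); lia.
have ln_pos : (0 < ln (6 * INR k))%coqR by rewrite -ln_1; apply: ln_increasing; lra.
have ln_le : (ln (6 * INR k) <= 6 * INR k - 1)%coqR.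
  have := exp_ineq1_le (ln (6 * INR k)); rewrite exp_ln; lra.
have X0 : (0 < X)%coqR by rewrite /X; apply: Rmult_lt_0_compat; lra.
have z0 : (0 < ceilR X)%Z by apply: lt_IZR; lra.
exists (Z.to_nat (ceilR X)); set P := Z.to_nat _.
have PE : IZR (ceilR X) = INR P by rewrite INR_IZR_INZ Z2Nat.id //; lia.
rewrite PE in thr cl cu.
split; first by lia.
  apply/leP/INR_le; apply: Rle_trans thr.
  rewrite INR_muln INR_addn; apply: Rmult_le_compat_l; first exact: pos_INR.
  apply: Rplus_le_compat_l; apply: (Rmult_le_reg_r (INR k)); first lra.
  rewrite -INR_muln /Rdiv Rmult_assoc Rinv_l ?Rmult_1_r; last lra.
  by apply: le_INR; apply/leP; exact: leq_divM.
apply/ltP/INR_lt; rewrite INR_muln !INR_expn.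
set M := (4 * k); have M_gt0 : 0 < M by rewrite /M; lia.
have ME : INR M = (4 * INR k)%coqR by rewrite /M INR_muln /=; lra.
have Mp : (0 < INR M ^ P)%coqR by apply: pow_lt; lra.
(* Dividing [P >= 18k ln(6k)] by [4k] gives [4.5 ln(6k)], more than the [4 ln(6k)] required. *)
have expb : (exp (- (INR P / INR M)) <= / (6 * INR k) ^ 4)%coqR.
  rewrite exp_Ropp; apply: Rinv_le_contravar; first by apply: pow_lt; lra.
  rewrite -{1}(exp_ln (6 * INR k)); last lra.
  rewrite -exp_INR_mult.
  have h : (INR 4 * ln (6 * INR k) <= INR P / INR M)%coqR.
    rewrite ME; apply: (Rmult_le_reg_r (4 * INR k)); first lra.
    rewrite /Rdiv (Rmult_assoc (INR P)) Rinv_l; last lra.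
    have : (0 < INR k * ln (6 * INR k))%coqR by apply: Rmult_lt_0_compat; lra.
    move: cl; rewrite /X /=; lra.
  by case: h => [h|->]; [left; exact: exp_increasing | right].
(* From [ln(6k) <= 6k - 1] follows [P <= 108 k^2], so [P M <= 432 k^3 < 1296 k^4]. *)
have PM : (INR (P * M) < (6 * INR k) ^ 4)%coqR.
  rewrite INR_muln ME.
  have P2 : (INR P <= 108 * (INR k * INR k))%coqR.
    have : (INR k * ln (6 * INR k) <= INR k * (6 * INR k - 1))%coqR.
      by apply: Rmult_le_compat_l; lra.
    move: cu; rewrite /X; lra.
  set r := INR k in k1 P2 *.
  have r2 : (1 <= r * r)%coqR by nra.
  have r3 : (1 <= r * r * r)%coqR by nra.
  apply: (Rle_lt_trans _ (432 * (r * r * r))%coqR); first by nra.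
  have -> : ((6 * r) ^ 4 = 1296 * (r * r * r) * r)%coqR by ring.
  nra.
have := pred_expn_le P M_gt0 => hM.
have k6 : (0 < (6 * INR k) ^ 4)%coqR by apply: pow_lt; lra.
have PM0 : (0 <= INR (P * M))%coqR := pos_INR _.
apply: (Rle_lt_trans _ (INR (P * M) * (INR M ^ P * / (6 * INR k) ^ 4)))%coqR.
  apply: Rmult_le_compat_l => //; apply: Rle_trans hM _.
  by apply: Rmult_le_compat_l => //; lra.
have -> : (INR (P * M) * (INR M ^ P * / (6 * INR k) ^ 4) =
          INR M ^ P * (INR (P * M) * / (6 * INR k) ^ 4))%coqR by ring.
rewrite -{2}(Rmult_1_r (INR M ^ P)); apply: Rmult_lt_compat_l => //.
apply: (Rmult_lt_reg_r ((6 * INR k) ^ 4)) => //.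
by rewrite Rmult_assoc Rinv_l; lra.
Qed.

(** * Greedy covering *)

(* Picking in each phase the part that covers most of what is left shrinks the
   set of uncovered points by a factor [1 - 1/M]. *)
Lemma greedy_cover (A : eqType) (B : seq A) (M P : nat)
    (cov : nat -> nat -> pred A) :
  0 < M ->
  (forall p b, p < P -> b \in B -> exists2 i, i < M & cov p i b) ->
  exists2 ch : nat -> nat,
    forall p, p < P -> ch p < M &
    count (fun b => ~~ has (fun p => cov p (ch p) b) (iota 0 P)) B * M ^ P
      <= size B * M.-1 ^ P.
Proof.
move=> M_gt0; elim: P => [|P IHP] covP.
  by exists (fun=> 0) => //=; rewrite !expn0 !muln1 count_size.
have [|ch chM chB] := IHP; first by move=> p b pP; apply: covP; lia.
set un := fun b => ~~ has (fun p => cov p (ch p) b) (iota 0 P) in chB.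
pose C := [seq b <- B | un b].
(* Pigeonhole: the [M] parts together cover all of [C], so some part covers at least a [1/M] share
   of it. *)
have [i iM Ci] : exists2 i, i < M & size C <= M * count (cov P i) C.
  have [/hasP[i]|/hasPn none] :=
      boolP (has (fun i => size C <= M * count (cov P i) C) (iota 0 M)).
    by rewrite mem_iota => /andP[_ iM] Ci; exists i.
  exfalso.
  have le_sum : size C <= \sum_(0 <= i < M) count (cov P i) C.
    under eq_bigr do rewrite -sum1_count big_mkcond.
    rewrite exchange_big /= -sum1_size [X in _ <= X]big_seq.
    rewrite [X in X <= _]big_seq; apply: leq_sum => b.
    rewrite mem_filter => /andP[_ /(covP P)-/(_ (ltnSn P))[i iM cPi]].
    by rewrite (bigD1_seq i) /= ?iota_uniq ?mem_index_iota // cPi.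
  have : M * \sum_(0 <= i < M) count (cov P i) C <= \sum_(0 <= i < M) (size C).-1.
    rewrite big_distrr big_nat [X in _ <= X]big_nat; apply: leq_sum => i /= iM.
    have := none i; rewrite mem_iota /= iM -ltnNge => /(_ isT); lia.
  rewrite sum_nat_const_nat subn0 leq_pmul2l //.
  have : 0 < size C; last by lia.
  have := none 0; rewrite mem_iota /= M_gt0 => /(_ isT); lia.
exists (fun p => if p == P then i else ch p) => [p|].
  by case: eqP => // pP; rewrite ltnS => p_le; apply: chM; lia.
set u' := count _ B.
have -> : u' = count (predC (cov P i)) C.
  rewrite /u' count_filter; apply: eq_count => b.
  rewrite [RHS]/= -[in iota _ _]addn1 iotaD has_cat negb_or add0n /= eqxx orbF andbC.
  congr (_ && ~~ _).
  apply: eq_in_has => p; rewrite mem_iota => /andP[_ pP].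
  by rewrite ifN //; apply/eqP; lia.
have := count_predC (cov P i) C.
have CE : size C = count un B by rewrite size_filter.
have : size C * M ^ P <= size B * M.-1 ^ P by rewrite CE.
rewrite !expnS; move: Ci; move: (M ^ P) (M.-1 ^ P) => x y Ci Cx Csum.
have : count (predC (cov P i)) C * M <= size C * M.-1 by nia.
by move=> h; nia.
Qed.

(** * A tour of the spanning tree *)

Lemma closed_tour (V : finType) (T : rel V) (x0 : V) :
  is_simple_graph T -> connected_graph T ->
  exists p : seq V, [/\ path T x0 p, (forall x, x \in x0 :: p),
    size p = (#|V|.-1).*2 &
    forall e, count_mem e (pairmap (fun a b => [set a; b]) x0 p) <= 2].
Proof.
move=> [symT _] connT.
suff build n : n < #|V| -> exists p : seq V, [/\ path T x0 p,
    #|[set y in x0 :: p]| = n.+1, size p = n.*2 &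
    forall e, count_mem e (pairmap (fun a b => [set a; b]) x0 p) <= 2].
  have V_gt0 : 0 < #|V| by apply/card_gt0P; exists x0.
  have [|p [pT pn sp ep]] := build #|V|.-1; first by lia.
  exists p; split=> // x.
  have : [set y in x0 :: p] == [set: V].
    by rewrite eqEcard subsetT cardsT pn prednK ?leqnn.
  by move=> /eqP/setP/(_ x); rewrite !inE.
elim: n => [|n IHn] nV.
  exists [::]; split=> //; rewrite -(cards1 x0).
  by apply: eq_card => z; rewrite !inE.
have [|p [pT pn sp ep]] := IHn; first lia.
have [y yp] : exists y, y \notin x0 :: p.
  apply/existsP; rewrite -negb_forall; apply/negP => /forallP all_p.
  have : #|V| <= #|[set y in x0 :: p]|.
    by apply/subset_leq_card/subsetP => z _; rewrite inE all_p.
  lia.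
(* The first edge by which a path from [x0] to [y] leaves the visited set. *)
have [u [w [up wp Tuw]]] : exists u w, [/\ u \in x0 :: p, w \notin x0 :: p & T u w].
  have /connectP[q qT yE] := connT x0 y.
  have : x0 \in x0 :: p by rewrite mem_head.
  move: qT yE; move: {1 2 3}x0 => x; elim: q x => [|z q IHq] x /=.
    by move=> _ yx xp; rewrite yx xp in yp.
  move=> /andP[Txz qT] yE xp; have [zp|zp] := boolP (z \in x0 :: p).
    exact: IHq zp.
  by exists x, z.
case/splitPl: up wp pT pn sp ep {yp} => p1 p2 p1u wp pT pn sp ep.
exists (p1 ++ w :: u :: p2); split.
- move: pT; rewrite !cat_path /= p1u => /andP[-> ->].
  by rewrite Tuw symT Tuw.
- have -> : [set y in x0 :: p1 ++ w :: u :: p2] = w |: [set y in x0 :: p1 ++ p2].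
    apply/setP => z; rewrite !inE !mem_cat !inE.
    have [->|_] := eqVneq z u; last by do !case: (_ == _) (_ \in _) => [] [].
    have : u \in x0 :: p1 by rewrite -p1u mem_last.
    by rewrite inE; case: (u == x0) (u \in p1) => [] [] //=; rewrite ?orbT.
  by rewrite cardsU1 inE wp pn.
- by move: sp; rewrite !size_cat doubleS /=; lia.
move=> e; have := ep e; rewrite !pairmap_cat !count_cat /= p1u.
rewrite (setUC [set w]).
have [<-|_] := eqVneq [set u; w] e; last by rewrite !add0n.
have no_w q z : z != w -> w \notin q ->
    count_mem [set u; w] (pairmap (fun a b => [set a; b]) z q) = 0.
  elim: q z => //= z' q IHq z zw; rewrite inE negb_or => /andP[wz' wq].
  rewrite IHq // 1?eq_sym // addn0; apply/eqP; rewrite eqb0; apply/eqP.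
  move=> /setP/(_ w); rewrite !inE eqxx orbT.
  by rewrite eq_sym (negPf zw) (negPf wz').
move: wp; rewrite inE mem_cat !negb_or => /and3P[wx0 wp1 wp2].
have uw : u != w.
  have : u \in x0 :: p1 by rewrite -p1u mem_last.
  by apply: contraTneq => uw; rewrite uw inE negb_or wx0.
by rewrite !no_w // eq_sym.
Qed.

(** * Temporal walks in time windows *)

Lemma twalk_in_cat (V : finType) (G : nat -> rel V) (a b c : nat) (v : V)
    (s1 s2 : seq (nat * V)) :
  a <= b.+1 -> b <= c ->
  twalk_in G a b v s1 -> twalk_in G b.+1 c (walk_end v s1) s2 ->
  twalk_in G a c v (s1 ++ s2).
Proof.
rewrite /twalk_in /walk_end => ab bc /andP[p1 /allP a1] /andP[p2 /allP a2].
rewrite cat_path p1 all_cat /=; apply/andP; split; last first.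
  by apply/andP; split; apply/allP => q; [move=> /a1 | move=> /a2]; lia.
have : (last (0, v) s1).1 <= b.
  by have /predU1P[->|/a1 /andP[]] := mem_last (0, v) s1.
case: s2 p2 a2 => //= q s2; rewrite /walk_step /= => /andP[/andP[_ Gq] ->] a2 lb.
have -> : (last (0, v) s1).2 = last v (map snd s1).
  by rewrite (last_map snd s1 (0, v)).
have := a2 q (mem_head _ _); rewrite Gq; lia.
Qed.

(** Times increase strictly from 0, so the step bound in explorability comes for free. *)
Lemma size_twalk_in (V : finType) (G : nat -> rel V) (a b : nat) (v : V)
    (s : seq (nat * V)) :
  twalk_in G a b v s -> size s <= b.
Proof.
rewrite /twalk_in -[size s]/((0, v).1 + size s) => /andP[].
have : (0, v).1 <= b by [].
elim: s (0, v) => [|q s IHs] p; first by rewrite addn0.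
move=> _ /= /andP[/andP[pq _] qs] /andP[/andP[_ qb] sb].
by have := IHs q qb qs sb; lia.
Qed.

(** * Virtual walkers on the tour *)

(** Walkers live on positions [0..N] of the tour [w], not on vertices: distinct positions may carry
    the same vertex. Position [N] is absorbing. *)
Definition advance (V : finType) (G : nat -> rel V) (w : nat -> V) (N t y : nat) :=
  if (y < N) && G t (w y) (w y.+1) then y.+1 else y.

Fixpoint run (V : finType) (G : nat -> rel V) (w : nat -> V) (N a l y : nat) :=
  if l is l'.+1 then advance G w N (a + l') (run G w N a l' y) else y.

Section Run.
Context (V : finType) (G : nat -> rel V) (w : nat -> V) (N a : nat).

Lemma run_le l y : y <= N -> run G w N a l y <= N.
Proof.
move=> yN; elim: l => //= l; rewrite /advance; case: ifP => // /andP[]; lia.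
Qed.

Lemma run_mono l1 l2 y : l1 <= l2 -> run G w N a l1 y <= run G w N a l2 y.
Proof.
move=> /subnKC <-; elim: (l2 - l1) => [|d]; first by rewrite addn0.
by rewrite addnS /= /advance; case: ifP; lia.
Qed.

(** A virtual walker is realised by a temporal walk; it moves by at most one position at a time, so
    it skips no position in between. *)
Lemma walk_run l y :
  0 < a -> exists s, [/\ twalk_in G a (a + l - 1) (w y) s,
    walk_end (w y) s = w (run G w N a l y) &
    forall z, y <= z <= run G w N a l y -> w z \in w y :: map snd s].
Proof.
move=> a_gt0; elim: l => [|l [s [sw se sz]]] /=.
  by exists [::]; split=> // z yzy; have -> : z = y by [lia]; rewrite mem_head.
rewrite /advance; set r := run _ _ _ _ _ _ in se sz *.
case: ifP => [/andP[rN Gr]|_]; last first.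
  exists s; split=> //; rewrite -[s]cats0.
  by apply: twalk_in_cat sw _ => //; lia.
exists (s ++ [:: (a + l, w r.+1)]); split.
- apply: twalk_in_cat sw _; [lia|lia|].
  by rewrite /twalk_in se /= /walk_step /= Gr; lia.
- by rewrite /walk_end map_cat last_cat.
- move=> z; rewrite map_cat -cat_cons mem_cat => zr.
  have [zr'|->] : z <= r \/ z = r.+1 by lia.
    by rewrite sz //; lia.
  by rewrite mem_head orbT.
Qed.

(** Each of the at most [k] missing edges lies at no more than two tour positions, and distinct
    walkers occupy distinct positions. *)
Lemma blocked_walkers (T : rel V) k t m (pos : nat -> nat) :
  (forall y, y < N -> T (w y) (w y.+1)) ->
  (forall e, count (fun y => [set w y; w y.+1] == e) (iota 0 N) <= 2) ->
  edge_deficient k T (G t) ->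
  (forall i, i < m -> pos i < N) ->
  (forall i j, i < j < m -> pos i < pos j) ->
  count (fun i => ~~ G t (w (pos i)) (w (pos i).+1)) (iota 0 m) <= 2 * k.
Proof.
move=> wT w2 def posN pos_inc.
pose blocked y := ~~ G t (w y) (w y.+1).
apply: (@leq_trans (count blocked (iota 0 N))).
  rewrite -!size_filter -(size_map pos); apply: uniq_leq_size.
    rewrite map_inj_in_uniq ?filter_uniq ?iota_uniq // => i j.
    rewrite !mem_filter !mem_iota => /andP[_ /andP[_ im]] /andP[_ /andP[_ jm]] pij.
    have [ij|ji|//] := ltngtP i j.
      by have := pos_inc i j; lia.
    by have := pos_inc j i; lia.
  move=> y /mapP[i]; rewrite !mem_filter mem_iota => /andP[bi /andP[_ im]] ->.
  by rewrite /blocked bi mem_iota posN.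
apply: (@leq_trans (\sum_(e in missing_edges T (G t))
    count (fun y => [set w y; w y.+1] == e) (iota 0 N))).
  rewrite -sum1_count big_mkcond /=.
  under [X in _ <= X]eq_bigr do rewrite -sum1_count big_mkcond /=.
  rewrite exchange_big big_seq [X in _ <= X]big_seq; apply: leq_sum => y.
  rewrite mem_iota /blocked => /andP[_ yN]; case: ifP => // by_.
  rewrite (bigD1 [set w y; w y.+1]) /= ?eqxx // inE.
  apply/existsP; exists (w y); apply/existsP; exists (w y.+1).
  by rewrite eqxx wT.
apply: (@leq_trans (\sum_(e in missing_edges T (G t)) 2)).
  by apply: leq_sum => e _.
by rewrite sum_nat_const mulnC leq_mul2l.
Qed.

(* Consecutive walkers start just behind the final position of the previous
   one, so at any time they occupy distinct positions. *)
Lemma walkers_progress (T : rel V) k m l (x : nat -> nat) :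
  (forall y, y < N -> T (w y) (w y.+1)) ->
  (forall e, count (fun y => [set w y; w y.+1] == e) (iota 0 N) <= 2) ->
  (forall i, i < m -> x i.+1 = (run G w N a l (x i)).+1) ->
  x m <= N ->
  x 0 + count (fun t => edge_deficient k T (G t)) (iota a l) * (m - 2 * k) + m
    <= x m.
Proof.
move=> wT w2 xS xmN.
pose def t := edge_deficient k T (G t).
have x_inc i j : i < j <= m -> run G w N a l (x i) < x j.
  move=> /andP[ij]; rewrite -(subnKC ij).
  elim: (j - _) => [|d IHd] dm; first by rewrite addn0 xS //; lia.
  rewrite addnS xS; last by lia.
  have := IHd ltac:(lia); have := run_mono (x (i.+1 + d)) (leq0n l) => /=; lia.
(* The sum of all positions is the potential: every deficient snapshot raises it by at least
   [m - 2 * k]. *)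
have prog l' : l' <= l -> \sum_(0 <= i < m) x i + count def (iota a l') * (m - 2 * k)
    <= \sum_(0 <= i < m) run G w N a l' (x i).
  elim: l' => [|l' IHl'] l'l; first by rewrite addn0.
  rewrite -(addn1 l') iotaD count_cat mulnDl addnA /= addn1.
  apply: (@leq_trans (\sum_(0 <= i < m) run G w N a l' (x i) +
      (def (a + l') + 0) * (m - 2 * k))).
    by rewrite leq_add2r IHl' // ltnW.
  set pos := fun i => run G w N a l' (x i).
  (* Since [x m <= N], no walker reaches the end of the tour; only a missing edge can stop one. *)
  have pos_lt i : i < m -> pos i < N.
    move=> im; have := x_inc i m; have := run_mono (x i) (ltnW l'l); rewrite /pos.
    lia.
  have adv : \sum_(0 <= i < m) run G w N a l'.+1 (x i) =
      \sum_(0 <= i < m) pos i +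
      count (fun i => G (a + l') (w (pos i)) (w (pos i).+1)) (iota 0 m).
    rewrite -sum1_count [X in _ = _ + X]big_mkcond -{3}(subn0 m) -big_split.
    apply: eq_big_nat => i /andP[_ im]; have := pos_lt i im; rewrite /= /advance /pos => ->.
    by case: (G _ _ _); rewrite /= ?addn1 ?addn0.
  rewrite adv leq_add2l addn0.
  case: (boolP (def _)) => [dt|_]; last by rewrite mul0n.
  have := @blocked_walkers T k (a + l') m pos wT w2 dt pos_lt.
  have pos_inc i j : i < j < m -> pos i < pos j.
    move=> ij; have := x_inc i j; have := run_mono (x i) (ltnW l'l).
    have := run_mono (x j) (leq0n l'); rewrite /pos /=; lia.
  move=> /(_ pos_inc).
  have := count_predC (fun i => G (a + l') (w (pos i)) (w (pos i).+1)) (iota 0 m).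
  by rewrite size_iota mul1n leq_subLR => cE hb; rewrite -[X in X <= _]cE addnC leq_add2r.
have := prog l (leqnn l).
(* Telescoping: each final position is one less than the next start, so the total progress is
   [x m - x 0 - m]. *)
have : \sum_(0 <= i < m) run G w N a l (x i) + m + x 0 = \sum_(0 <= i < m) x i + x m.
  elim: m xS {xmN x_inc prog} => [|m IHm] xS; first by rewrite !big_geq.
  rewrite !big_nat_recr //=; have := IHm (fun i im => xS i (ltnW im)).
  by have := xS m (ltnSn m); lia.
rewrite -/def; lia.
Qed.

End Run.

(** * One interval per phase covers the tour *)

(* It is enough to cover the breakpoints: if an interval containing a
   breakpoint [b <= y] stops before [y], the next breakpoint of its phase lies in [(b, y]]. *)
Lemma interval_cover (P M N : nat) (x : nat -> nat -> nat) :
  0 < P -> 0 < M -> P * M * M.-1 ^ P < M ^ P ->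
  (forall p, p < P -> x p 0 = 0) -> (forall p, p < P -> N < x p M) ->
  exists ch : nat -> nat, forall y, y <= N ->
    exists2 p, p < P & x p (ch p) <= y < x p (ch p).+1.
Proof.
move=> P_gt0 M_gt0 PM x0 xM.
pose B := [seq b <- [seq x p i | p <- iota 0 P, i <- iota 0 M] | b <= N].
have memB p i : p < P -> i < M -> x p i <= N -> x p i \in B.
  move=> pP iM xN; rewrite mem_filter xN /=.
  by apply: allpairs_f; rewrite mem_iota.
have sizeB : size B <= P * M.
  rewrite size_filter; apply: leq_trans (count_size _ _) _.
  by rewrite size_allpairs !size_iota.
have in_part p b : p < P -> b <= N -> exists2 i, i < M & x p i <= b < x p i.+1.
  move=> pP bN; have : b < x p M by exact: leq_ltn_trans (xM p pP).
  elim: (M) => [|i IHi]; first by rewrite x0.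
  have [xb bx|bx _] := leqP (x p i) b; first by exists i; rewrite ?xb.
  by have [j ji xj] := IHi bx; exists j; first exact: ltnW.
have [p b pP|ch chM] := @greedy_cover _ B M P (fun p i b => x p i <= b < x p i.+1) M_gt0.
  by rewrite mem_filter => /andP[bN _]; exact: in_part.
rewrite leqNgt; set u := count _ B => chB.
(* Otherwise [M ^ P <= u * M ^ P <= P * M * M.-1 ^ P], against [PM]. *)
have u0 : u = 0.
  apply/eqP; rewrite -leqn0 leqNgt; apply: contra chB => u_gt0.
  apply: (@leq_ltn_trans (P * M * M.-1 ^ P)); first by rewrite leq_mul2r sizeB orbT.
  by apply: leq_trans PM _; rewrite leq_pmull.
exists ch => y yN.
(* Induction on the distance from a breakpoint [b] up to [y], starting at the breakpoint 0. *)
suff cover m b : y - b <= m -> b \in B -> b <= y ->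
    exists2 p, p < P & x p (ch p) <= y < x p (ch p).+1.
  apply: (cover y (x 0 0)); rewrite ?x0 ?subn0 //.
  by rewrite -(x0 0 P_gt0); apply: memB; rewrite ?x0.
elim: m b => [|m IHm] b ybm bB b_le;
  have /hasP[p] : has (fun p => x p (ch p) <= b < x p (ch p).+1) (iota 0 P).
- have := u0; move/eqP; rewrite -leqn0 leqNgt -has_count => /hasPn/(_ b bB).
  by rewrite negbK.
- rewrite mem_iota => /andP[_ pP] xb; exists p => //.
  by have -> : y = b by lia.
- have := u0; move/eqP; rewrite -leqn0 leqNgt -has_count => /hasPn/(_ b bB).
  by rewrite negbK.
rewrite mem_iota => /andP[_ pP] /andP[xb bx].
have [yx|xy] := ltnP y (x p (ch p).+1); first by exists p => //; lia.
apply: (IHm (x p (ch p).+1)) => //; first by lia.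
apply: memB => //; last by lia.
(* [B] omits the index [M], but [x p M] exceeds [N] and so cannot be the endpoint reached here. *)
have := chM p pP; rewrite leq_eqVlt => /predU1P[chE|//].
by have := xM p pP; rewrite -chE; lia.
Qed.

(** * Cutting time into phases and joining their walks *)

(** The number of [d]-times up to [t] grows by at most one per step, so it attains each [p * q] with
    [p <= P]; [tau p] is the first time it does. Phase [p] consists of the times after [tau p] up to
    [tau p.+1]. *)
Lemma split_times (d : pred nat) (L q P : nat) :
  P * q <= count d (iota 1 L) ->
  exists tau : nat -> nat, [/\ tau 0 = 0, tau P <= L &
    forall p, p < P -> tau p <= tau p.+1 /\
      count d (iota (tau p).+1 (tau p.+1 - tau p)) = q].
Proof.
move=> PL; pose c t := count d (iota 1 t).
have c_cat t t' : t <= t' -> c t' = c t + count d (iota t.+1 (t' - t)).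
  by move=> tt; rewrite /c -{1}(subnKC tt) iotaD count_cat add1n.
have ivt i : i <= c L -> exists2 t, t <= L & c t = i.
  elim: (L) => [|t IHt]; first by rewrite /c /= leqn0 => /eqP->; exists 0.
  have [ic _|ic] := leqP i (c t).
    by have [t' t't ct'] := IHt ic; exists t' => //; exact: leqW.
  rewrite (c_cat t) // subSnn /= => ic'; exists t.+1 => //.
  by rewrite (c_cat t) // subSnn /=; lia.
have {}ivt p : p <= P -> exists t, (t <= L) && (c t == p * q).
  move=> pP; have [|t tL ct] := ivt (p * q).
    by apply: leq_trans PL; rewrite leq_mul2r pP orbT.
  by exists t; rewrite tL ct eqxx.
pose tau p := find (fun t => p * q <= c t) (iota 0 L.+1).
have hasc p : p <= P -> has (fun t => p * q <= c t) (iota 0 L.+1).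
  move=> /ivt[t /andP[tL /eqP ct]]; apply/hasP; exists t; last by rewrite ct.
  by rewrite mem_iota.
have tauL p : p <= P -> tau p <= L.
  by move=> /hasc; rewrite has_find size_iota.
have tauE p : p <= P -> c (tau p) = p * q.
  move=> pP; have := nth_find 0 (hasc p pP).
  rewrite -/(tau p) nth_iota ?ltnS ?tauL // add0n => c_ge.
  have := tauL p pP; case tE: (tau p) => [|t] tL.
    by move: c_ge; rewrite tE /c /=; lia.
  have := @before_find _ 0 (fun t => p * q <= c t) (iota 0 L.+1) t.
  rewrite -/(tau p) tE nth_iota ?add0n; last by lia.
  move=> /(_ (ltnSn t)); move: c_ge; rewrite tE (c_cat t) // subSnn /=; lia.
exists tau; split=> [||p pP]; [by [] | exact: tauL |].
have le_tau : tau p <= tau p.+1.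
  by apply: sub_find => t /=; apply: leq_trans; rewrite leq_mul2r leqnSn orbT.
split=> //; have := tauE p.+1 pP; rewrite (c_cat _ _ le_tau) tauE; last exact: ltnW.
by rewrite mulSn addnC => /addIn.
Qed.

(** In phase [p] the first [Delta] snapshots lead from the current vertex to [w (x p)]; the rest of
    the phase follows the tour from there. *)
Lemma walk_phases (V : finType) (L : nat) (G : nat -> rel V) (Delta : nat)
    (w : nat -> V) (N P : nat) (tau x : nat -> nat) (v : V) :
  Delta_temporally_connected L G Delta ->
  (forall p, p < P -> tau p + Delta <= tau p.+1) -> tau P <= L ->
  exists2 s, twalk_in G 1 (tau P) v s &
    forall p z, p < P ->
      x p <= z <= run G w N (tau p + Delta).+1 (tau p.+1 - (tau p + Delta)) (x p) ->
      w z \in v :: map snd s.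
Proof.
move=> dtc; elim: P => [|P IHP] tauS tauL; first by exists [::].
have tP := tauS P (ltnSn P).
have [||s sw sz] := IHP; [by move=> p pP; apply: tauS; lia | by lia |].
have [||s1 [s1w s1e]] := dtc (tau P).+1 _ _ (walk_end v s) (w (x P)); [by []|by lia|].
have [//|s2 [s2w _ s2z]] := @walk_run _ G w N (tau P + Delta).+1
  (tau P.+1 - (tau P + Delta)) (x P).
have e1 : (tau P).+1 + Delta - 1 = tau P + Delta by lia.
have e2 : (tau P + Delta).+1 + (tau P.+1 - (tau P + Delta)) - 1 = tau P.+1 by lia.
rewrite e1 in s1w; rewrite e2 in s2w.
exists (s ++ s1 ++ s2).
  apply: twalk_in_cat sw _ => //; first by lia.
  apply: twalk_in_cat s1w _ => //; first by lia.
  by rewrite s1e.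
move=> p z; rewrite ltnS leq_eqVlt => /predU1P[->|pP] zx; last first.
  by rewrite map_cat -cat_cons mem_cat (sz p z pP zx).
have := s2z z zx; rewrite !map_cat !inE !mem_cat => /orP[/eqP->|->]; last by rewrite !orbT.
have : w (x P) \in walk_end v s :: map snd s1 by rewrite -s1e mem_last.
rewrite inE => /orP[/eqP->|->]; last by rewrite !orbT.
by have := mem_last v (map snd s); rewrite inE orbA => ->.
Qed.

(** * Assembling the exploration *)

Theorem theorem1 (Delta k n : nat) (V : finType) (L : nat) (G : nat -> rel V)
  (T : rel V) :
  #|V| = n ->
  1 <= k ->
  temporal_graph L G ->
  Delta_temporally_connected L G Delta ->
  spanning_tree_of T (underlying L G) ->
  Rle (snapshot_threshold k Delta n) (INR (num_deficient L G k T)) ->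
  forall v : V, explorable L G v.
Proof.
move=> Vn k_gt0 _ dtc [sT _ cT _] thr v.
have n_gt0 : 0 < n by rewrite -Vn; apply/card_gt0P; exists v.
have [P [P_gt0 Pq PM]] := phase_count k_gt0 thr.
have [p [pT p_all p_size p_edges]] := closed_tour v sT cT.
pose w := nth v (v :: p); pose N := size p.
have wT y : y < N -> T (w y) (w y.+1) by move=> yN; exact: (pathP v pT).
have w2 e : count (fun y => [set w y; w y.+1] == e) (iota 0 N) <= 2.
  apply: leq_trans (p_edges e).
  have -> : pairmap (fun a b => [set a; b]) v p = [seq [set w y; w y.+1] | y <- iota 0 N].
    apply: (@eq_from_nth _ set0) => [|i]; rewrite size_pairmap ?size_map ?size_iota //.
    by move=> ip; rewrite (nth_pairmap v) // (nth_map 0) ?size_iota // nth_iota.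
  by rewrite count_map.
have [tau [tau0 tauP tauS]] := split_times Pq.
(* A phase has at least as many time steps as its [Delta + n %/ k] deficient snapshots. *)
have tau_Delta q : q < P -> tau q + Delta <= tau q.+1.
  move=> /tauS[tq tc].
  have := count_size (fun t => edge_deficient k T (G t)) (iota (tau q).+1 (tau q.+1 - tau q)).
  by rewrite tc size_iota; move: (n %/ k) tq; clear; lia.
pose a q := (tau q + Delta).+1; pose l q := tau q.+1 - (tau q + Delta).
pose x q i := iter i (fun y => (run G w N (a q) (l q) y).+1) 0.
(* At most [Delta] deficient snapshots fall in the transfer time, so [n %/ k] remain. If [4 * k]
   walkers fitted on the tour, they would use at least [2k (n %/ k) + 4k > 2n] positions, but
   [N = 2 (n - 1)]. *)
have x_end q : q < P -> N < x q (4 * k).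
  move=> qP; rewrite ltnNge; apply/negP => xN.
  have := @walkers_progress _ G w N (a q) T k (4 * k) (l q) (x q) wT w2
    (fun i _ => erefl) xN.
  have [_] := tauS q qP.
  have -> : tau q.+1 - tau q = Delta + l q by have := tau_Delta q qP; rewrite /l; lia.
  rewrite iotaD count_cat addSn -/(a q).
  have := count_size (fun t => edge_deficient k T (G t)) (iota (tau q).+1 Delta).
  rewrite size_iota; move: (count _ _) (count _ _) => c2 c1 c1D c12.
  have : n %/ k <= c2 by rewrite -(leq_add2l Delta) -c12 leq_add2r.
  have := ltn_ceil n k_gt0; move: xN; rewrite /N p_size Vn /x /=.
  by move: (iter _ _ _) (n %/ k) => X D; nia.
have [||ch chP] := @interval_cover P (4 * k) N x P_gt0 _ PM _ x_end; [lia|by []|].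
have [s sw sz] := @walk_phases _ _ _ _ w N P tau (fun q => x q (ch q)) v dtc tau_Delta tauP.
have sL : twalk L G v s.
  by rewrite /twalk -[s]cats0; apply: twalk_in_cat sw _ => //.
exists s; split=> //; split; first exact: size_twalk_in sL.
move=> u; have := p_all u; rewrite -index_mem /= ltnS => uN.
have [q qP uq] := chP _ uN.
by have := sz q _ qP uq; rewrite /w nth_index.
Qed.
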